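(* Let $X$ be a set of symbols and let $P,Q,R \subseteq \mathbb{Q}[X]$ be finite sets of polynomials. Let $F$ be the ground conjunctive formula \[ F = \Big(\bigwedge_{p\in P} 0 \le p\Big) \land \Big(\bigwedge_{q \in Q} \lnot (0 \le q)\Big) \land \Big(\bigwedge_{r\in R}\lnot(0 = r)\Big). \] Let $C$ be the least regular cone in $\mathbb{Q}[X]$ that contains $P$. Then $F$ is satisfiable modulo $\mathbf{LRR}$ if and only if $C$ is consistent and $\mathfrak{M}(C) \models F$.
   Context: Atoms with rational coefficients are abbreviations for $\sigma_{or}(X)$-atoms (clear denominators and move terms), where $\sigma_{or}$ has $+,\cdot,0,1,=,\le$ and $\sigma_{or}(X)$ adds $X$ as constants. $\mathbf{LRR}$ is the $\sigma_{or}$-theory axiomatized by: the commutative ring axioms; reflexivity, transitivity and antisymmetry of $\le$; $\forall x,y,z\,(x\le y \Rightarrow x+z\le y+z)$; $0\le 1\land 0\ne 1$; for each integer $n\ge1$, $\exists x\,(x+\dots+x=1)$ ($n$ summands); for each integer $n\ge1$, $\forall x\,(0\le x+\dots+x \Rightarrow 0\le x)$ ($n$ summands). A cone in $\mathbb{Q}[X]$ contains $0$ and is closed under addition and multiplication by non-negative rationals; $\mathrm{units}(C)=\{p: p\in C,-p\in C\}$; $C$ is regular if $1\in C$ and $\mathrm{units}(C)$ is an ideal; consistent if $C\ne \mathbb{Q}[X]$. $\mathfrak{M}(C)$ is the $\sigma_{or}(X)$-structure with universe and ring operations those of $\mathbb{Q}[X]/I$, $I = \mathrm{units}(C)$, each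 $x\in X$ interpreted as $x+I$, and $\le$ interpreted as $\{(p+I,q+I): q-p\in C\}$. *)

(* Defs.v *)
From HB Require Import structures.
From mathcomp Require Import all_boot all_order all_algebra.
From mathcomp Require Import finmap.
From mathcomp Require Import boolp classical_sets.
From mathcomp Require Import monalg.

Set Implicit Arguments.
Unset Strict Implicit.
Unset Printing Implicit Defensive.

Import Order.TTheory GRing.Theory Num.Theory.

Local Open Scope classical_set_scope.
Local Open Scope ring_scope.
Local Open Scope quotient_scope.

(* First-order logic (with equality) over the ordered-ring signature extended
   with a set X of constant symbols; variables are de Bruijn indices.  Formulas
   over the signature without constants are those in which [TCst] does not
   occur. *)
Inductive term (X : Type) : Type :=
| TVar of nat
| TCst of X
| TZero
| TOne
| TAdd of term X & term X
| TMul of term X & term X.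

Arguments TVar {X}.
Arguments TZero {X}.
Arguments TOne {X}.

Inductive formula (X : Type) : Type :=
| FTrue
| FEq of term X & term X
| FLe of term X & term X
| FNot of formula X
| FAnd of formula X & formula X
| FImp of formula X & formula X
| FAll of formula X
| FEx of formula X.

Arguments FTrue {X}.

Record structure (X : Type) : Type := Structure {
  univ : Type;
  izero : univ;
  ione : univ;
  iadd : univ -> univ -> univ;
  imul : univ -> univ -> univ;
  ile : univ -> univ -> Prop;
  icst : X -> univ
}.

Definition env_cons (T : Type) (a : T) (e : nat -> T) (n : nat) : T :=
  if n is n'.+1 then e n' else a.

Fixpoint eval (X : Type) (M : structure X) (e : nat -> univ M) (t : term X)
    : univ M :=
  match t with
  | TVar n => e n
  | TCst x => icst M x
  | TZero => izero M
  | TOne => ione M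
  | TAdd s t => iadd (eval e s) (eval e t)
  | TMul s t => imul (eval e s) (eval e t)
  end.

Fixpoint holds (X : Type) (M : structure X) (e : nat -> univ M)
    (f : formula X) : Prop :=
  match f with
  | FTrue => True
  | FEq s t => eval e s = eval e t
  | FLe s t => ile (eval e s) (eval e t)
  | FNot f => ~ holds e f
  | FAnd f g => holds e f /\ holds e g
  | FImp f g => holds e f -> holds e g
  | FAll f => forall a : univ M, holds (env_cons a e) f
  | FEx f => exists a : univ M, holds (env_cons a e) f
  end.

Definition models (X : Type) (M : structure X) (f : formula X) : Prop :=
  forall e : nat -> univ M, holds e f.

Definition satisfiable_modulo (X : Type) (T : set (formula X)) (f : formula X)
    : Prop :=
  exists M : structure X, (forall g, T g -> models M g) /\ models M f.

(* t + ... + t with n summands (and 0 if n = 0). *)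
Definition nsum (X : Type) (n : nat) (t : term X) : term X :=
  iterop n (@TAdd X) t TZero.

Inductive LRR (X : Type) : set (formula X) :=
| LRR_addA : let x := TVar 0 in let y := TVar 1 in let z := TVar 2 in
    LRR (FAll (FAll (FAll
      (FEq (TAdd x (TAdd y z)) (TAdd (TAdd x y) z)))))
| LRR_addC : let x := TVar 0 in let y := TVar 1 in
    LRR (FAll (FAll (FEq (TAdd x y) (TAdd y x))))
| LRR_add0 : let x := TVar 0 in
    LRR (FAll (FEq (TAdd TZero x) x))
| LRR_opp : let y := TVar 0 in let x := TVar 1 in
    LRR (FAll (FEx (FEq (TAdd x y) TZero)))
| LRR_mulA : let x := TVar 0 in let y := TVar 1 in let z := TVar 2 in
    LRR (FAll (FAll (FAll
      (FEq (TMul x (TMul y z)) (TMul (TMul x y) z)))))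
| LRR_mulC : let x := TVar 0 in let y := TVar 1 in
    LRR (FAll (FAll (FEq (TMul x y) (TMul y x))))
| LRR_mul1 : let x := TVar 0 in
    LRR (FAll (FEq (TMul TOne x) x))
| LRR_mulD : let x := TVar 0 in let y := TVar 1 in let z := TVar 2 in
    LRR (FAll (FAll (FAll
      (FEq (TMul (TAdd x y) z) (TAdd (TMul x z) (TMul y z))))))
| LRR_le_refl : let x := TVar 0 in
    LRR (FAll (FLe x x))
| LRR_le_trans : let x := TVar 0 in let y := TVar 1 in let z := TVar 2 in
    LRR (FAll (FAll (FAll (FImp (FAnd (FLe x y) (FLe y z)) (FLe x z)))))
| LRR_le_anti : let x := TVar 0 in let y := TVar 1 in
    LRR (FAll (FAll (FImp (FAnd (FLe x y) (FLe y x)) (FEq x y))))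
| LRR_le_add : let x := TVar 0 in let y := TVar 1 in let z := TVar 2 in
    LRR (FAll (FAll (FAll
      (FImp (FLe x y) (FLe (TAdd x z) (TAdd y z))))))
| LRR_01 : LRR (FAnd (FLe TZero TOne) (FNot (FEq TZero TOne)))
| LRR_div n : let x := TVar 0 in (1 <= n)%N ->
    LRR (FEx (FEq (nsum n x) TOne))
| LRR_unperf n : let x := TVar 0 in (1 <= n)%N ->
    LRR (FAll (FImp (FLe TZero (nsum n x)) (FLe TZero x))).

(* The polynomial ring Q[X] in a possibly infinite set X of indeterminates. *)
Notation Qpoly X := {malg rat[{cmonom X}]}.

Section Atoms.
Variable X : choiceType.
Implicit Types (p : Qpoly X) (m : {cmonom X}).

Definition monom_term m : term X :=
  \big[@TMul X/TOne]_(x <- finsupp m) iterop (m x) (@TMul X) (TCst x) TOne.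

Definition natpoly_term (s : seq {cmonom X}) (c : {cmonom X} -> nat) : term X :=
  \big[@TAdd X/TZero]_(m <- s) nsum (c m) (monom_term m).

Definition common_den p : nat :=
  (\prod_(m <- msupp p) `|denq p@_m|)%N.

Definition int_coeff p m : int := numq ((common_den p)%:R * p@_m).

Definition nat_part (z : int) : nat := if z is Posz n then n else 0%N.

Definition pos_term p :=
  natpoly_term (msupp p) (fun m => nat_part (int_coeff p m)).
Definition neg_term p :=
  natpoly_term (msupp p) (fun m => nat_part (- int_coeff p m)).

(* An atom with rational coefficients abbreviates the one obtained by clearing
   the denominators and moving the monomials with negative coefficients to the
   other side; see [clear_denominators]. *)
Definition atom_le0 p : formula X := FLe (neg_term p) (pos_term p).
Definition atom_eq0 p : formula X := FEq (neg_term p) (pos_term p).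

Definition bigand (s : seq (formula X)) : formula X := foldr (@FAnd X) FTrue s.

Definition ground_formula (P Q R : {fset Qpoly X}) : formula X :=
  FAnd (bigand [seq atom_le0 p | p <- P])
  (FAnd (bigand [seq FNot (atom_le0 q) | q <- Q])
        (bigand [seq FNot (atom_eq0 r) | r <- R])).

Fixpoint term_poly (t : term X) : Qpoly X :=
  match t with
  | TVar _ => 0
  | TCst x => << ucm x >>
  | TZero => 0
  | TOne => 1
  | TAdd s t => term_poly s + term_poly t
  | TMul s t => term_poly s * term_poly t
  end.

Lemma common_den_gt0 p : (0 < common_den p)%N.
Proof. by apply/prodn_gt0 => m; rewrite absz_gt0 denq_neq0. Qed.

Lemma int_coeffE p m :
  m \in msupp p -> (int_coeff p m)%:~R = (common_den p)%:R * p@_m.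
Proof.
move=> mp; rewrite /int_coeff /common_den (big_fsetD1 m) //= natrM.
rewrite -[X in _ * X]divq_num_den.
set k := (\prod_(i <- _) _)%N.
have dE : (`|denq p@_m|%N)%:R = (denq p@_m)%:~R :> rat.
  by rewrite -[in RHS](gez0_abs (denq_ge0 _)).
have -> : (`|denq p@_m|%N)%:R * k%:R * ((numq p@_m)%:~R / (denq p@_m)%:~R)
    = (k%:Z * numq p@_m)%:~R :> rat.
  rewrite dE intrM mulrAC [_ * (_ / _)]mulrC.
  by rewrite divfK ?intr_eq0 ?denq_neq0 1?mulrC.
by rewrite numq_int.
Qed.

Lemma term_poly_monom m : term_poly (monom_term m) = << m >>.
Proof.
rewrite /monom_term (big_morph term_poly (id1 := 1) (op1 := *%R)) //.
have -> : << m >> = \prod_(x <- finsupp m) (<< ucm x >> ^+ m x) :> Qpoly X.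
  have mE : m = \big[mmul/mone]_(x <- finsupp m) iter (m x) (mmul (ucm x)) mone.
    apply/eqP/cmP => i.
    rewrite (big_morph (fun k : {cmonom X} => k i) (id1 := 0%N) (op1 := addn)).
    - have iE x : iter (m x) (mmul (ucm x)) mone i = (m x * (x == i))%N.
        elim: (m x) => [|n IH]; first by rewrite /= cm1 mul0n.
        by rewrite iterS cmM IH cmU mulSn.
      case: (mdomP m i) => im.
        rewrite (big_fsetD1 i) //= iE eqxx muln1 big1_seq ?addn0 //.
        move=> x /andP[_]; rewrite in_fsetD1 iE => /andP[/negPf-> _].
        by rewrite muln0.
      rewrite big1_seq // => x /andP[_ xm]; rewrite iE.
      by case: eqP => [xi|_]; rewrite ?muln0 //; rewrite -xi xm in im.
    - by move=> a b; rewrite cmM.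
    - by rewrite cm1.
  rewrite [in LHS]mE.
  rewrite (big_morph (fun k => << k >> : Qpoly X) (id1 := 1) (op1 := *%R)) //.
    apply: eq_bigr => x _; elim: (m x) => [|n IH] //=.
    by rewrite exprS -IH malgM_def fgmulUU mulr1.
  by move=> a b; rewrite malgM_def fgmulUU mulr1.
apply: eq_bigr => x _; case: (m x) => [|n] //.
elim: n => [|n IH]; first by rewrite expr1.
by rewrite exprS -IH.
Qed.

Lemma term_poly_natpoly s c :
  term_poly (natpoly_term s c) = \sum_(m <- s) << (c m)%:R *g m >>.
Proof.
rewrite /natpoly_term (big_morph term_poly (id1 := 0) (op1 := +%R)) //.
apply: eq_bigr => m _; rewrite -mulr_natr mulr_natr monalgUMn -term_poly_monom.
case: (c m) => [|n]; first by rewrite mulr0n.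
elim: n => [|n IH] //.
by rewrite mulrS -IH.
Qed.

Lemma clear_denominators p :
  (common_den p)%:R *: p = term_poly (pos_term p) - term_poly (neg_term p).
Proof.
rewrite !term_poly_natpoly -sumrB [in X in _ *: X](monalgE p) scaler_sumr.
apply: eq_big_seq => m mp.
have := int_coeffE mp; move: (int_coeff p m) (p@_m) (_%:R) => z a d zE.
have -> : d *: << a *g m >> = << d * a *g m >> :> Qpoly X.
  by rewrite -mul_malgC malgM_def fgmulUU mul1m.
rewrite -zE; case: z {zE} => n.
  have -> : nat_part (- Posz n) = 0%N by case: n.
  by rewrite monalgU0 subr0.
by rewrite NegzE opprK /= monalgU0 sub0r -monalgUN mulrNz.
Qed.

End Atoms.

Section Cones.
Variable X : choiceType.
Implicit Types (C D I : set (Qpoly X)) (P : {fset Qpoly X}).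

Definition cone C : Prop :=
  [/\ C 0,
      forall p q, C p -> C q -> C (p + q)
    & forall (c : rat) p, 0 <= c -> C p -> C (c *: p)].

Definition units C : set (Qpoly X) := [set p | C p /\ C (- p)].

(* Unlike [idealr_closed], this allows the improper ideal. *)
Definition ideal I : Prop :=
  [/\ I 0,
      forall p q, I p -> I q -> I (p + q)
    & forall p q, I q -> I (p * q)].

Definition regular_cone C : Prop := [/\ cone C, C 1 & ideal (units C)].

Definition consistent C : Prop := C <> setT.

Definition least_regular_cone P C : Prop :=
  [/\ regular_cone C, [set` P] `<=` C
    & forall D, regular_cone D -> [set` P] `<=` D -> C `<=` D].

Lemma least_regular_cone_regular P C :
  least_regular_cone P C -> regular_cone C.
Proof. by case. Qed.

Lemma least_regular_cone_exists P : exists C, least_regular_cone P C.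
Proof.
exists [set p | forall D, regular_cone D -> [set` P] `<=` D -> D p].
split; last by move=> D rD PD p; apply.
  split.
  - split=> [D [[]]|p q Cp Cq D rD PD|c p c0 Cp D rD PD] //.
      by case: (rD) => -[_ + _] _ _; apply; [apply: Cp|apply: Cq].
    by case: (rD) => -[_ _ +] _ _; apply=> //; apply: Cp.
  - by move=> D [].
  - split.
    + by split=> D [[D0 _ _] _ _] _; rewrite ?oppr0.
    + move=> p q [Cp Cp'] [Cq Cq']; split=> D rD PD; case: (rD) => -[_ aD _] _ _.
        by apply: aD; [apply: Cp|apply: Cq].
      by rewrite opprD; apply: aD; [apply: Cp'|apply: Cq'].
    + move=> p q [Cq Cq']; split=> D rD PD; case: (rD) => _ _ [_ _ mD].
        by have [] := mD p q (conj (Cq D rD PD) (Cq' D rD PD)).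
      by have [] := mD p q (conj (Cq D rD PD) (Cq' D rD PD)).
by move=> p Pp D rD PD; apply: PD.
Qed.

End Cones.

Section QuotientStructure.
Variables (X : choiceType) (C : set (Qpoly X)) (regC : regular_cone C).

(* The unused proof lets the instance below be found from [units_pred regC]. *)
Definition units_pred of regular_cone C : {pred Qpoly X} :=
  fun p => `[< units C p >].

Lemma units_zmod_closed : zmod_closed (units_pred regC).
Proof.
have [_ _ [I0 ID IM]] := regC; split=> [|p q /asboolP up /asboolP uq].
  exact/asboolP.
by apply/asboolP/ID => //; rewrite -mulN1r; apply: IM.
Qed.

HB.instance Definition _ :=
  GRing.isZmodClosed.Build (Qpoly X) (units_pred regC) units_zmod_closed.

(* The library's quotient by a subgroup is used because its quotient rings
   require a proper ideal; [pi_quot_mul] shows that the multiplication is the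
   induced one. *)
Local Notation quot_units := (Quotient.quot (units_pred regC)).

Definition quot_mul (a b : quot_units) : quot_units :=
  \pi_quot_units (repr a * repr b).

Definition quot_le (a b : quot_units) : Prop :=
  exists p q : Qpoly X,
    [/\ a = \pi_quot_units p,
        b = \pi_quot_units q & C (q - p)].

Definition cone_structure : structure X :=
  {| univ := quot_units;
     izero := \pi_quot_units 0;
     ione := \pi_quot_units 1;
     iadd := fun a b => a + b;
     imul := quot_mul;
     ile := quot_le;
     icst := fun x => \pi_quot_units << ucm x >> |}.

Lemma pi_quot_eq (p q : Qpoly X) :
  \pi_quot_units p =
    \pi_quot_units q <-> units C (p - q).
Proof.
by split=> [/eqP|u]; [|apply/eqP]; rewrite -Quotient.idealrBE;
  [move/asboolP|apply/asboolP].
Qed.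

Lemma pi_quot_mul (p q : Qpoly X) :
  quot_mul (\pi_quot_units p)
           (\pi_quot_units q)
  = \pi_quot_units (p * q).
Proof.
have [_ _ [_ ID IM]] := regC; rewrite /quot_mul; apply/pi_quot_eq.
set p' := repr _; set q' := repr _.
have up : units C (p' - p) by apply/pi_quot_eq; rewrite reprK.
have uq : units C (q' - q) by apply/pi_quot_eq; rewrite reprK.
have -> : p' * q' - p * q = p' * (q' - q) + q * (p' - p).
  by rewrite !mulrBr (mulrC q p') (mulrC q p) addrA subrK.
by apply: ID; apply: IM.
Qed.

End QuotientStructure.

(* Main.v *)
From HB Require Import structures.
Require Import Defs.
From mathcomp Require Import all_boot all_order all_algebra.
From mathcomp Require Import finmap boolp classical_sets monalg.

(** A model [M] of LRR is a commutative ring in which every positive integer is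
    invertible, hence a Q-algebra, so the interpretation of the constants
    extends to a ring morphism [phi : Q[X] -> M].  Unperforation makes
    [0 <= p] hold in [M] iff [0 <= phi p], and antisymmetry makes the units of
    the cone [D = {p | 0 <= phi p}] the kernel of [phi]; thus [D] is a regular
    cone, and it contains [C] if [M] satisfies [F].  The negated atoms of [F]
    therefore remain true when [M] is replaced by the structure of [C].
    Conversely the structure of a consistent regular cone is a model of LRR. *)

Set Implicit Arguments.
Unset Strict Implicit.
Unset Printing Implicit Defensive.

Import Order.TTheory GRing.Theory Num.Theory.

Local Open Scope classical_set_scope.
Local Open Scope ring_scope.
Local Open Scope quotient_scope.

(** * Ground terms *)

Section GroundTerms.
Variable X : choiceType.
Implicit Types (t : term X) (p : Qpoly X).

(** [term_poly] sends every variable to [0], so it can agree with evaluation only on terms without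
    variables. *)
Fixpoint ground t : bool :=
  match t with
  | TVar _ => false
  | TCst _ | TZero | TOne => true
  | TAdd s t | TMul s t => ground s && ground t
  end.

Lemma ground_iterop (op : term X -> term X -> term X) n t z :
  (forall a b, ground a -> ground b -> ground (op a b)) ->
  ground t -> ground z -> ground (iterop n op t z).
Proof.
move=> opP gt gz; case: n => [|n] //.
by elim: n => [|n IH] //; rewrite /iterop iteriS; apply: opP.
Qed.

Lemma ground_natpoly (s : seq {cmonom X}) c : ground (natpoly_term s c).
Proof.
rewrite /natpoly_term; apply: (big_ind ground) => //= [a b -> ->|m _] //.
apply: ground_iterop => //= [a b -> -> //|].
apply: (big_ind ground) => //= [a b -> ->|x _] //.
by apply: ground_iterop => //= a b -> ->.
Qed.

(** The hypotheses are spelled out on the bare operations of [M] so that [phi] can be a ring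
    morphism into a model as well as the projection onto the quotient by [units C], whose product is
    only the function [quot_mul]. *)
Lemma eval_ground (M : structure X) (phi : Qpoly X -> univ M) :
  phi 0 = izero M -> phi 1 = ione M ->
  {morph phi : p q / p + q >-> iadd p q} ->
  {morph phi : p q / p * q >-> imul p q} ->
  (forall x, phi << ucm x >> = icst M x) ->
  forall e t, ground t -> eval e t = phi (term_poly t).
Proof.
move=> phi0 phi1 phiD phiM phiX e; elim=> //= s IHs t IHt /andP[gs gt].
  by rewrite phiD IHs ?IHt.
by rewrite phiM IHs ?IHt.
Qed.

Lemma holds_bigand (I : eqType) (M : structure X) (e : nat -> univ M)
    (f : I -> formula X) (s : seq I) :
  holds e (bigand [seq f i | i <- s]) <-> {in s, forall i, holds e (f i)}.
Proof.
elim: s => [|i s IH] /=; first by split.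
rewrite IH; split=> [[fi fs] j|fs].
  by rewrite inE => /predU1P[->|/fs].
by split=> [|j js]; apply: fs; rewrite inE ?eqxx ?js ?orbT.
Qed.

Lemma holds_ground_formula (M : structure X) (e : nat -> univ M)
    (P Q R : {fset Qpoly X}) :
  holds e (ground_formula P Q R) <->
  [/\ {in P, forall p, holds e (atom_le0 p)},
      {in Q, forall q, ~ holds e (atom_le0 q)}
    & {in R, forall r, ~ holds e (atom_eq0 r)}].
Proof.
rewrite /ground_formula /= !holds_bigand /=.
by split=> [[? [? ?]]|[? ? ?]].
Qed.

End GroundTerms.

(** * Morphisms from Q[X] to divisible commutative rings *)

Section DivisibleRing.
Variable A : comNzRingType.
Hypothesis divA : forall n, (0 < n)%N -> exists x : A, x *+ n = 1.

(** The image of [|d|] in [A] has an inverse, so multiplication by [d] is injective. *)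
Lemma mulrz_eq0_divisible (x : A) (d : int) : d != 0 -> x *~ d = 0 -> x = 0.
Proof.
move=> d0 xd0; have [] := @divA `|d|%N; first by rewrite absz_gt0.
move=> y yd; rewrite -[x]mulr1 -yd mulrnAr -mulrnAl.
suff -> : x *+ `|d| = 0 by rewrite mul0r.
case: d xd0 {d0 yd} => n //=.
by rewrite NegzE mulrNz => /eqP; rewrite oppr_eq0 => /eqP.
Qed.

Lemma mulrz_inj_divisible (x y : A) (d : int) :
  d != 0 -> x *~ d = y *~ d -> x = y.
Proof.
move=> d0 xy; apply/eqP; rewrite -subr_eq0; apply/eqP.
by apply: (mulrz_eq0_divisible d0); rewrite mulrzBl xy subrr.
Qed.

Lemma rat_rmorphism_exists : inhabited {rmorphism rat -> A}.
Proof.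
have /choice[f fE] : forall q : rat, exists x : A, x *~ denq q = (numq q)%:~R.
  move=> q; have [] := @divA `|denq q|%N; first by rewrite absz_gt0 denq_neq0.
  move=> y yd; exists (y *~ numq q).
  by rewrite mulrzAC -(gez0_abs (denq_ge0 q)) -pmulrn yd.
have dE q : q * (denq q)%:~R = (numq q)%:~R.
  by rewrite -{1}(divq_num_den q) divfK ?intr_eq0 ?denq_neq0.
(* Any fraction [a / b] equal to [q], reduced or not, determines [f q]; sums and products can thus
   be compared over the denominator [denq p * denq q]. *)
have fP q a b : b != 0 -> q * b%:~R = a%:~R -> f q *~ b = a%:~R.
  move=> b0 qE; apply: (mulrz_inj_divisible (denq_neq0 q)).
  rewrite mulrzAC fE -!mulrzA; congr (_ *~ _).
  apply: (@intr_inj rat); rewrite !intrM -qE -dE; exact: mulrAC.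
have d2 p q : denq p * denq q != 0 by rewrite mulf_neq0 ?denq_neq0.
have fB : zmod_morphism f.
  move=> p q; apply: (mulrz_inj_divisible (d2 p q)).
  rewrite (fP _ (numq p * denq q - numq q * denq p)) //.
    rewrite mulrzBl !mulrzA fE mulrzAC fE mulrzBr.
    by rewrite -!mulrzA.
  rewrite rmorphB !rmorphM /= -!dE mulrBl.
  by congr (_ - _); rewrite 1?[X in _ * X]mulrC ?mulrA //; apply: mulrAC.
have fM : monoid_morphism f.
  split; first by apply: (fP 1 1 1); rewrite ?mulr1.
  move=> p q; apply: (mulrz_inj_divisible (d2 p q)).
  rewrite (fP _ (numq p * numq q)) //.
    by rewrite [RHS]mulrzA -mulrzAl -mulrzAr !fE intrM.
  by rewrite !rmorphM /= -!dE mulrACA.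
pose aM := GRing.isZmodMorphism.Build rat A f fB.
pose mM := GRing.isMonoidMorphism.Build rat A f fM.
pose g : {rmorphism rat -> A} := HB.pack f aM mM.
by constructor.
Qed.

Lemma Qpoly_rmorphism_exists (X : choiceType) (v : X -> A) :
  exists phi : {rmorphism Qpoly X -> A}, forall x, phi << ucm x >> = v x.
Proof.
have [f] := rat_rmorphism_exists.
pose h (m : {cmonom X}) := \prod_(x <- finsupp m) v x ^+ m x.
(* Exponents vanish outside the support, so two monomials and their product can all be evaluated
   over the union of the two supports. *)
have hE (m : {cmonom X}) (d : {fset X}) : (finsupp m `<=` d)%fset ->
    h m = \prod_(x <- d) v x ^+ m x.
  move=> md; rewrite /h (big_fset_incl _ md) // => x _ xm.
  by rewrite fsfun_dflt.
have hM : mmorphism h.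
  split=> [m1 m2|]; last by rewrite /h mdom1 big_seq_fset0.
  rewrite (hE _ (finsupp m1 `|` finsupp m2)%fset) ?mdomD //.
  rewrite (hE m1 (finsupp m1 `|` finsupp m2)%fset) ?fsubsetUl //.
  rewrite (hE m2 (finsupp m1 `|` finsupp m2)%fset) ?fsubsetUr //.
  by rewrite -big_split; apply: eq_bigr => x _; rewrite cmM exprD.
pose hmM := isMultiplicative.Build {cmonom X} A h hM.
pose g : {mmorphism {cmonom X} -> A} := HB.pack h hmM.
exists (mmap f g) => x; rewrite [LHS]mmapU /= rmorph1 mul1r /h mdomU.
by rewrite big_seq_fset1 cmUU expr1.
Qed.

End DivisibleRing.

(** * Models of LRR as rings *)

Section LRRModels.
Variables (X : choiceType) (M : structure X).
Hypothesis modM : forall g, @LRR X g -> models M g.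

(** The type records the proof of the axioms because the ring instances attached to it below are
    built from that proof. *)
Definition model_ring of (forall g, @LRR X g -> models M g) : Type := univ M.
Local Notation A := (model_ring modM).

Let e0 : nat -> univ M := fun=> izero M.

HB.instance Definition _ := gen_eqMixin A.
HB.instance Definition _ := gen_choiceMixin A.

Fact model_addA : associative (@iadd X M).
(* Index 0 belongs to the innermost quantifier, so the instances are supplied in the order [z], [y],
   [x]. *)
Proof. by move=> x y z; apply: (modM (@LRR_addA X) e0 z y x). Qed.

Fact model_addC : commutative (@iadd X M).
Proof. by move=> x y; apply: (modM (@LRR_addC X) e0 y x). Qed.

Fact model_add0 : left_id (izero M) (@iadd X M).
Proof. by move=> x; apply: (modM (@LRR_add0 X) e0 x). Qed.

Definition model_opp (x : univ M) : univ M :=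
  projT1 (cid (modM (@LRR_opp X) e0 x)).

Fact model_addN : left_inverse (izero M) model_opp (@iadd X M).
Proof.
by move=> x; rewrite model_addC /model_opp; case: cid => y.
Qed.

HB.instance Definition _ := GRing.isZmodule.Build A
  model_addA model_addC model_add0 model_addN.

Fact model_mulA : associative (@imul X M).
Proof. by move=> x y z; apply: (modM (@LRR_mulA X) e0 z y x). Qed.

Fact model_mulC : commutative (@imul X M).
Proof. by move=> x y; apply: (modM (@LRR_mulC X) e0 y x). Qed.

Fact model_mul1 : left_id (ione M) (@imul X M).
Proof. by move=> x; apply: (modM (@LRR_mul1 X) e0 x). Qed.

Fact model_mulD : left_distributive (@imul X M) (@iadd X M).
Proof. by move=> x y z; apply: (modM (@LRR_mulD X) e0 z y x). Qed.

Fact model_1neq0 : (ione M : A) != (izero M : A).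
Proof.
by have [_ n01] := modM (@LRR_01 X) e0; apply/eqP => h; apply: n01.
Qed.

HB.instance Definition _ := GRing.Zmodule_isComNzRing.Build A
  model_mulA model_mulC model_mul1 model_mulD model_1neq0.

Lemma eval_nsum e n (t : term X) : eval e (nsum n t) = (eval e t : A) *+ n.
Proof.
case: n => [|n] //; elim: n => [|n IH] //.
by rewrite mulrS -IH.
Qed.

Lemma model_divisible n : (0 < n)%N -> exists x : A, x *+ n = 1.
Proof.
move=> n0; have [x xE] := modM (LRR_div X n0) e0.
by exists x; move: xE; rewrite /= eval_nsum.
Qed.

(** * The order of a model *)

Local Notation le := (@ile X M : A -> A -> Prop).

Lemma model_le_refl (x : A) : le x x.
Proof. exact: (modM (@LRR_le_refl X) e0 x). Qed.

Lemma model_le_trans (y x z : A) : le x y -> le y z -> le x z.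
Proof. by move=> xy yz; apply: (modM (@LRR_le_trans X) e0 z y x). Qed.

Lemma model_le_anti (x y : A) : le x y -> le y x -> x = y.
Proof. by move=> xy yx; apply: (modM (@LRR_le_anti X) e0 y x). Qed.

Lemma model_le_add (x y z : A) : le x y -> le (x + z) (y + z).
Proof. by move=> xy; apply: (modM (@LRR_le_add X) e0 z y x). Qed.

Lemma model_le01 : le 0 1.
Proof. by have [] := modM (@LRR_01 X) e0. Qed.

Lemma model_unperforated n (x : A) : (0 < n)%N -> le 0 (x *+ n) -> le 0 x.
Proof.
move=> n0 xn; apply: (modM (LRR_unperf X n0) e0 x).
by rewrite /= eval_nsum.
Qed.

Lemma model_subr_ge0 (x y : A) : le 0 (y - x) <-> le x y.
Proof.
split=> [/(model_le_add x)|/(model_le_add (- x))].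
  by rewrite subrK add0r.
by rewrite subrr.
Qed.

Lemma model_addr_ge0 (x y : A) : le 0 x -> le 0 y -> le 0 (x + y).
Proof.
move=> x0 y0; apply: (model_le_trans y0).
by have := model_le_add y x0; rewrite add0r.
Qed.

Lemma model_mulrn_ge0 (x : A) n : le 0 x -> le 0 (x *+ n).
Proof.
move=> x0; elim: n => [|n IH]; first exact: model_le_refl.
by rewrite mulrS; apply: model_addr_ge0.
Qed.

(** * Polynomials that are non-negative in a model *)

Variable phi : {rmorphism Qpoly X -> A}.
Hypothesis phiX : forall x, phi << ucm x >> = icst M x.

(** Compatibility with the rational scalar [a / b], cleared of denominators so that only integer
    multiples occur in [A]. *)
Lemma rmorphZ_mulrn (c : rat) (p : Qpoly X) (a b : nat) :
  c * b%:R = a%:R -> phi (c *: p) *+ b = phi p *+ a.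
Proof.
by move=> cE; rewrite -!rmorphMn -!scaler_nat scalerA mulrC cE.
Qed.

Lemma pos_neg_termE e (p : Qpoly X) :
  (eval e (pos_term p) : A) - (eval e (neg_term p) : A) = phi p *+ common_den p.
Proof.
have evalE t : ground t -> eval e t = phi (term_poly t).
  apply: (@eval_ground X M phi _ _ _ _ phiX).
  - exact: (rmorph0 phi).
  - exact: (rmorph1 phi).
  - exact: (rmorphD phi).
  - exact: (rmorphM phi).
rewrite (evalE (pos_term p)) ?ground_natpoly //.
rewrite (evalE (neg_term p)) ?ground_natpoly //.
by rewrite -rmorphB -clear_denominators scaler_nat rmorphMn.
Qed.

(** The atom compares two terms whose difference is [common_den p] times [phi p]; unperforation
    removes this positive factor. *)
Lemma model_atom_le0 (e : nat -> univ M) (p : Qpoly X) :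
  holds e (atom_le0 p) <-> le 0 (phi p).
Proof.
rewrite /= -model_subr_ge0 pos_neg_termE.
by split; [apply: model_unperforated; apply: common_den_gt0
          |apply: model_mulrn_ge0].
Qed.

Lemma model_atom_eq0 (e : nat -> univ M) (p : Qpoly X) :
  phi p = 0 -> holds e (atom_eq0 p).
Proof.
move=> p0; apply/esym/(@subr0_eq A).
by rewrite pos_neg_termE p0 mul0rn.
Qed.

Definition nonneg_cone : set (Qpoly X) := [set p | le 0 (phi p)].

Lemma units_nonneg_cone p : units nonneg_cone p <-> phi p = 0.
Proof.
rewrite /units /nonneg_cone /= rmorphN; split=> [[p0 Np0]|->].
  by apply/esym/model_le_anti => //; apply/model_subr_ge0; rewrite sub0r.
by rewrite oppr0; split; apply: model_le_refl.
Qed.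

Lemma nonneg_cone_regular : regular_cone nonneg_cone.
Proof.
split.
- split; rewrite /nonneg_cone /=.
  + by rewrite rmorph0; apply: model_le_refl.
  + by move=> p q p0 q0; rewrite rmorphD; apply: model_addr_ge0.
  (* For [c = a / b], the multiple [b * phi (c *: p) = a * phi p] is non-negative, and unperforation
     divides by [b]. *)
  + move=> c p c0 p0; pose b := `|denq c|%N; pose a := `|numq c|%N.
    have b0 : (0 < b)%N by rewrite absz_gt0 denq_neq0.
    apply: (model_unperforated b0); rewrite (@rmorphZ_mulrn _ _ a).
      exact: model_mulrn_ge0.
    rewrite /a /b !pmulrn !gez0_abs ?denq_ge0 ?numq_ge0 //.
    by rewrite -{1}(divq_num_den c) divfK ?intr_eq0 ?denq_neq0.
- by rewrite /nonneg_cone /= rmorph1; apply: model_le01.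
- split.
  + by apply/units_nonneg_cone; rewrite rmorph0.
  + move=> p q /units_nonneg_cone p0 /units_nonneg_cone q0.
    by apply/units_nonneg_cone; rewrite rmorphD p0 q0 addr0.
  + move=> p q /units_nonneg_cone q0.
    by apply/units_nonneg_cone; rewrite rmorphM q0 mulr0.
Qed.

Lemma nonneg_cone_consistent : consistent nonneg_cone.
Proof.
move=> DT; have : units nonneg_cone 1 by rewrite DT.
by move/units_nonneg_cone; rewrite rmorph1 => /eqP; rewrite oner_eq0.
Qed.

End LRRModels.

(** * The structure of a regular cone *)

Section ConeStructure.
Variables (X : choiceType) (C : set (Qpoly X)) (regC : regular_cone C).
Local Notation M := (cone_structure regC).
Local Notation quot_units := (Quotient.quot (units_pred regC)).
Local Notation "\pi p" := (\pi_quot_units p) (at level 10).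

(** A cone is closed under scaling by [1 / n], so clearing denominators does not affect
    membership. *)
Lemma coneZn n (p : Qpoly X) : (0 < n)%N -> C (n%:R *: p) <-> C p.
Proof.
have [[_ _ CZ] _ _] := regC => n0.
split=> Cp; last by apply: CZ; rewrite ?ler0n.
have -> : p = n%:R^-1 *: (n%:R *: p).
  by rewrite scalerA mulVf ?scale1r // pnatr_eq0 -lt0n.
by apply: CZ; rewrite ?invr_ge0 ?ler0n.
Qed.

Lemma units_coneZn n (p : Qpoly X) :
  (0 < n)%N -> units C (n%:R *: p) <-> units C p.
Proof.
move=> n0; have [d1 u1] := coneZn p n0; have [d2 u2] := coneZn (- p) n0.
rewrite scalerN in d2 u2.
by split=> -[Cp CNp]; split; [apply: d1|apply: d2|apply: u1|apply: u2].
Qed.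

(** Other representatives change [q - p] by units, which lie in [C] together with their
    opposites. *)
Lemma quot_le_pi (p q : Qpoly X) :
  quot_le (\pi p) (\pi q) <-> C (q - p).
Proof.
split=> [[p' [q' [/pi_quot_eq[_ up] /pi_quot_eq[uq _] Cpq]]]|Cpq]; last first.
  by exists p, q.
have [[_ CD _] _ _] := regC.
have -> : q - p = q - q' + (q' - p') - (p - p').
  by rewrite addrA subrK opprB addrA subrK.
by apply: (CD) => //; apply: CD.
Qed.

Lemma pi_quot_add (p q : Qpoly X) :
  \pi (p + q) = \pi p + \pi q :> quot_units.
Proof. by rewrite -raddfD. Qed.

Lemma cone_eval (e : nat -> univ M) (t : term X) :
  ground t -> eval e t = \pi (term_poly t) :> quot_units.
Proof.
apply: (@eval_ground X M (fun p => \pi p) erefl erefl _ _ (fun=> erefl)).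
  exact: pi_quot_add.
by move=> p q; apply/esym/pi_quot_mul.
Qed.

Lemma cone_atom_le0 (e : nat -> univ M) p : holds e (atom_le0 p) <-> C p.
Proof.
rewrite /= !cone_eval ?ground_natpoly // quot_le_pi -clear_denominators.
exact/coneZn/common_den_gt0.
Qed.

Lemma cone_atom_eq0 (e : nat -> univ M) p :
  holds e (atom_eq0 p) <-> units C p.
Proof.
rewrite /= !cone_eval ?ground_natpoly //.
(* The equation is reversed because [clear_denominators] concerns the positive part minus the
   negative part. *)
have -> : (\pi (term_poly (neg_term p)) = \pi (term_poly (pos_term p))) <->
    (\pi (term_poly (pos_term p)) = \pi (term_poly (neg_term p))).
  by split=> ->.
rewrite pi_quot_eq -clear_denominators.
exact/units_coneZn/common_den_gt0.
Qed.

Lemma cone_nsum (e : nat -> univ M) n t p :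
  eval e t = \pi p -> eval e (nsum n t) = \pi (n%:R *: p).
Proof.
move=> tE; rewrite scaler_nat; case: n => [|n] //.
elim: n => [|n IH] //.
by rewrite mulrS pi_quot_add -IH -tE.
Qed.

Lemma units_1_inconsistent : units C 1 -> C = setT.
Proof.
have [_ _ [_ _ IM]] := regC => u1; apply/seteqP; split=> // p _.
by have [] := IM p 1 u1; rewrite mulr1.
Qed.

(** On representatives, transitivity becomes closure of [C] under addition, antisymmetry holds
    because units are killed, and the two axiom schemes come from scaling by [1 / n]. Consistency
    enters through [0 <> 1], since otherwise [1] would be a unit. *)
Lemma cone_structure_LRR : consistent C -> forall g, LRR g -> models M g.
Proof.
have [[C0 CD CZ] C1 [I0 ID IM]] := regC => consC g.
have piM := @pi_quot_mul X C regC.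
case=> /=.
- by move=> e x y z; apply: addrA.
- by move=> e x y; apply: addrC.
- by move=> e; elim/quotW => p /=; rewrite -pi_quot_add add0r.
- move=> e; elim/quotW => p; exists (\pi (- p)) => /=.
  by rewrite -pi_quot_add subrr.
- move=> e; elim/quotW => z; elim/quotW => y; elim/quotW => x /=.
  by rewrite (piM y z) (piM x (y * z)) (piM x y) (piM (x * y) z) mulrA.
- move=> e; elim/quotW => y; elim/quotW => x /=.
  by rewrite (piM x y) (piM y x) mulrC.
- by move=> e; elim/quotW => x /=; rewrite (piM 1 x) mul1r.
- move=> e; elim/quotW => z; elim/quotW => y; elim/quotW => x /=.
  by rewrite -pi_quot_add (piM x z) (piM y z) (piM (x + y) z)
    -pi_quot_add mulrDl.
- by move=> e; elim/quotW => x /=; apply/quot_le_pi; rewrite subrr.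
- move=> e; elim/quotW => z; elim/quotW => y; elim/quotW => x /=.
  by move=> [/quot_le_pi xy /quot_le_pi yz]; apply/quot_le_pi;
    rewrite -(subrKA y); apply: CD.
- move=> e; elim/quotW => y; elim/quotW => x /=.
  move=> [/quot_le_pi xy /quot_le_pi yx]; apply/pi_quot_eq.
  by split=> //; rewrite opprB.
- move=> e; elim/quotW => z; elim/quotW => y; elim/quotW => x /=.
  move=> /quot_le_pi xy; rewrite -!pi_quot_add; apply/quot_le_pi.
  by rewrite opprD addrACA subrr addr0.
- move=> e; split; first by apply/quot_le_pi; rewrite subr0.
  move/pi_quot_eq; rewrite sub0r => -[CN1 C1'].
  by apply/consC/units_1_inconsistent.
- move=> n n0 e; exists (\pi (n%:R^-1 *: 1)).
  rewrite /= (@cone_nsum _ n _ (n%:R^-1 *: 1)) //.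
  by rewrite scalerA mulfV ?pnatr_eq0 -?lt0n // scale1r.
- move=> n n0 e; elim/quotW => x; rewrite /= (@cone_nsum _ n _ x) //.
  by move=> /quot_le_pi; rewrite subr0 => /(coneZn x n0) Cx;
    apply/quot_le_pi; rewrite subr0.
Qed.

End ConeStructure.

(** * Comparing an arbitrary model with the structure of the least regular cone *)

Theorem theorem3p6 (X : choiceType) (P Q R : {fset Qpoly X})
    (C : set (Qpoly X)) (leastC : least_regular_cone P C) :
  satisfiable_modulo (@LRR X) (ground_formula P Q R) <->
  consistent C /\
  models (cone_structure (least_regular_cone_regular leastC))
    (ground_formula P Q R).
Proof.
split=> [[M [modM MF]]|[consC CF]]; last first.
  by exists (cone_structure (least_regular_cone_regular leastC)); split=> //;
    apply: cone_structure_LRR.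
have [phi phiX] :=
  Qpoly_rmorphism_exists (model_divisible modM) (@icst X M).
have [MP MQ MR] := (holds_ground_formula _ _ _ _).1 (MF (fun=> izero M)).
have [_ PC minC] := leastC.
(* Minimality of [C] is used here: every model of the formula makes all of [C] non-negative. *)
have CD : C `<=` nonneg_cone phi.
  apply: minC; first exact: nonneg_cone_regular.
  by move=> p /MP /(model_atom_le0 phiX).
split=> [CT|e].
  apply: (@nonneg_cone_consistent _ _ _ phi).
  by apply/seteqP; split=> // p _; apply: CD; rewrite CT.
apply/holds_ground_formula; split=> [p Pp|q Qq|r Rr].
- exact/cone_atom_le0/PC.
- by move/cone_atom_le0/CD => Dq; apply/(MQ q Qq)/(model_atom_le0 phiX).
- move/cone_atom_eq0 => -[Cr CNr]; apply: (MR r Rr).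
  (* If [r] and [- r] both lie in [C], then [phi r] and its opposite are non-negative, so
     [phi r = 0], against the literal for [r] in [M]. *)
  apply: (model_atom_eq0 phiX); apply/units_nonneg_cone.
  by split; apply: CD.
Qed.
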